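(* The homomorphism of $k$-algebras $$k[[a,b,c]]/\bigl(c^q-(ab)^{q-1}c-a^qQ(b)+b^qP(a)\bigr)\longrightarrow A^G,\qquad a\mapsto w,\quad b\mapsto w',\quad c\mapsto wu'-w'u,$$ where $a,b,c$ are indeterminates, is bijective.
   Context: Let $p$ be a prime, $q=p^s$ ($s\geq 1$), and $k$ an algebraically closed field of characteristic $p$. Let $P(w)=w+\mu_2w^2+\ldots+\mu_qw^q$ and $Q(w')=w'+\mu'_2w'^2+\ldots+\mu'_qw'^q$ be polynomials over $k$. Let $u,u',w,w'$ be four variables and set $$A=k[[u,w,u',w']]/\bigl(u^q-uw^{q-1}-P(w),\;u'^q-u'w'^{q-1}-Q(w')\bigr),$$ where the inclusion of $k[[u,u']]$ into $A$ is bijective, so $A=k[[u,u']]$. The additive group $G=\mathbb{F}_q\subset k$ acts on $A$, with $\lambda\in G$ acting via $u\mapsto u+\lambda w$, $u'\mapsto u'+\lambda w'$, $w\mapsto w$, $w'\mapsto w'$; $A^G$ denotes the ring of invariants. The elements $w,w',wu'-w'u\in A$ are invariant and satisfy $(wu'-w'u)^q=(ww')^{q-1}(wu'-w'u)+w^qQ(w')-w'^qP(w)$, so the homomorphism in the claim is well defined. ($A$ is the complete local ring at the fixed point of the diagonal $G$-action on the product of the Artin--Schreier curves $y^{q-1}+\mu_2y^{q-2}+\ldots+\mu_q=x^q-x$ and $y^{q-1}+\mu'_2y^{q-2}+\ldots+\mu'_q=x^q-x$.) *)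

(* Defs.v *)
From HB Require Import structures.
From mathcomp Require Import all_boot all_order all_algebra.
From mathcomp Require Import ring_quotient mpoly boolp.
From mathcomp Require Import ring.

Set Implicit Arguments.
Unset Strict Implicit.
Unset Printing Implicit Defensive.

Import GRing.Theory.
Local Open Scope ring_scope.
Local Open Scope quotient_scope.

(* Formal power series in n commuting variables over R, with 'X_{1..n} as the   *)
(* type of exponents; the ring axioms are proved by truncation to {mpoly R[n]}.  *)
Record fps (R : Type) (n : nat) := FPS { fcoef : 'X_{1..n} -> R }.

Lemma fpsP (R : Type) n (f g : fps R n) : fcoef f =1 fcoef g <-> f = g.
Proof.
split=> [|-> //]; case: f g => [f] [g] /= fg.
by congr FPS; apply/funext.
Qed.

HB.instance Definition _ (R : Type) n := gen_eqMixin (fps R n).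
HB.instance Definition _ (R : Type) n := gen_choiceMixin (fps R n).

Section FpsAlgebra.
Variables (R : comNzRingType) (n : nat).
Implicit Types (f g h : fps R n) (m : 'X_{1..n}).

Definition fps0 : fps R n := FPS (fun=> 0).
Definition fps_opp f : fps R n := FPS (fun m => - fcoef f m).
Definition fps_add f g : fps R n := FPS (fun m => fcoef f m + fcoef g m).
Definition fps1 : fps R n := FPS (fun m => (m == 0%MM)%:R).
Definition fps_mul f g : fps R n := FPS (fun m =>
  \sum_(h : 'X_{1..n < (mdeg m).+1, (mdeg m).+1} | m == (h.1 + h.2)%MM)
     fcoef f h.1 * fcoef g h.2).
Definition fps_scale (a : R) f : fps R n := FPS (fun m => a * fcoef f m).

Lemma fps_addA : associative fps_add.
Proof. by move=> f g h; apply/fpsP => m /=; rewrite addrA. Qed.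
Lemma fps_addC : commutative fps_add.
Proof. by move=> f g; apply/fpsP => m /=; rewrite addrC. Qed.
Lemma fps_add0 : left_id fps0 fps_add.
Proof. by move=> f; apply/fpsP => m /=; rewrite add0r. Qed.
Lemma fps_addN : left_inverse fps0 fps_opp fps_add.
Proof. by move=> f; apply/fpsP => m /=; rewrite addNr. Qed.

HB.instance Definition _ := GRing.isZmodule.Build (fps R n)
  fps_addA fps_addC fps_add0 fps_addN.

Definition ftrunc d f : {mpoly R[n]} :=
  \sum_(h : 'X_{1..n < d}) fcoef f h *: 'X_[h].

Lemma ftruncE d f m : (mdeg m < d)%N -> (ftrunc d f)@_m = fcoef f m.
Proof. exact: mcoeff_mpoly. Qed.

Lemma mcoeffM_low d (p p' r r' : {mpoly R[n]}) m :
    (forall m', (mdeg m' < d)%N -> p@_m' = p'@_m') ->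
    (forall m', (mdeg m' < d)%N -> r@_m' = r'@_m') ->
  (mdeg m < d)%N -> (p * r)@_m = (p' * r')@_m.
Proof.
move=> pp' rr' md; rewrite !mcoeffM; apply: eq_bigr => -[[h1 l1] [h2 l2]] _ /=.
by rewrite pp' ?rr' ?(leq_trans _ md).
Qed.

Lemma fcoef_mul d f g m : (mdeg m < d)%N ->
  fcoef (fps_mul f g) m = (ftrunc d f * ftrunc d g)@_m.
Proof.
move=> md; rewrite mcoeffM /=; apply: eq_bigr => -[[h1 l1] [h2 l2]] _ /=.
by rewrite !ftruncE ?(leq_trans _ md).
Qed.

Lemma ftruncM d f g m : (mdeg m < d)%N ->
  (ftrunc d (fps_mul f g))@_m = (ftrunc d f * ftrunc d g)@_m.
Proof. by move=> md; rewrite ftruncE // (fcoef_mul _ _ md). Qed.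

Lemma fps_mulA : associative fps_mul.
Proof.
move=> f g h; apply/fpsP => m; rewrite !(fcoef_mul _ _ (ltnSn _)).
rewrite (@mcoeffM_low (mdeg m).+1 _ (ftrunc (mdeg m).+1 f) _
  (ftrunc (mdeg m).+1 g * ftrunc (mdeg m).+1 h)) //; last exact: ftruncM.
by rewrite mulrA; apply: (@mcoeffM_low (mdeg m).+1) => // m' m'd; rewrite ftruncM.
Qed.

Lemma fps_mulC : commutative fps_mul.
Proof.
by move=> f g; apply/fpsP => m; rewrite !(fcoef_mul _ _ (ltnSn _)) mulrC.
Qed.

Lemma fps_mul1 : left_id fps1 fps_mul.
Proof.
move=> f; apply/fpsP => m; rewrite !(fcoef_mul _ _ (ltnSn _)).
rewrite (@mcoeffM_low (mdeg m).+1 _ 1 _ (ftrunc (mdeg m).+1 f)) //.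
  by rewrite mul1r ftruncE.
by move=> m' m'd; rewrite ftruncE // mcoeff1.
Qed.

Lemma fps_mulDl : left_distributive fps_mul +%R.
Proof.
move=> f g h; apply/fpsP => m.
transitivity (fcoef (fps_mul f h) m + fcoef (fps_mul g h) m); last by [].
rewrite !(fcoef_mul _ _ (ltnSn _)) -mcoeffD -mulrDl; apply: (@mcoeffM_low (mdeg m).+1) => // m' m'd.
by rewrite mcoeffD !ftruncE.
Qed.

Lemma fps1_neq0 : fps1 != 0.
Proof.
apply/eqP => /fpsP/(_ 0%MM) /=; rewrite eqxx => /eqP.
by rewrite oner_eq0.
Qed.

HB.instance Definition _ := GRing.Zmodule_isComNzRing.Build (fps R n)
  fps_mulA fps_mulC fps_mul1 fps_mulDl fps1_neq0.

Lemma fps_scaleA a b f : fps_scale a (fps_scale b f) = fps_scale (a * b) f.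
Proof. by apply/fpsP => m /=; rewrite mulrA. Qed.
Lemma fps_scale1 : left_id 1 fps_scale.
Proof. by move=> f; apply/fpsP => m /=; rewrite mul1r. Qed.
Lemma fps_scaleDr : right_distributive fps_scale +%R.
Proof. by move=> a f g; apply/fpsP => m /=; rewrite mulrDr. Qed.
Lemma fps_scaleDl f : {morph fps_scale^~ f : a b / a + b}.
Proof. by move=> a b; apply/fpsP => m /=; rewrite mulrDl. Qed.

HB.instance Definition _ := GRing.Zmodule_isLmodule.Build R (fps R n)
  fps_scaleA fps_scale1 fps_scaleDr fps_scaleDl.

Lemma fps_scaleAl (a : R) f g : a *: (f * g) = (a *: f) * g.
Proof.
apply/fpsP => m /=; rewrite mulr_sumr.
by apply: eq_bigr => h _; rewrite mulrA.
Qed.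

HB.instance Definition _ := GRing.Lmodule_isLalgebra.Build R (fps R n) fps_scaleAl.
HB.instance Definition _ := GRing.Lalgebra_isComAlgebra.Build R (fps R n).

Lemma fcoefD f g m : fcoef (f + g) m = fcoef f m + fcoef g m.
Proof. by []. Qed.
Lemma fcoefZ a f m : fcoef (a *: f) m = a * fcoef f m.
Proof. by []. Qed.
Lemma fcoef_is_zmod_morphism m : zmod_morphism (fun f => fcoef f m).
Proof. by []. Qed.
Lemma fcoef_sum m (I : Type) (r : seq I) (P : pred I) (F : I -> fps R n) :
  fcoef (\sum_(i <- r | P i) F i) m = \sum_(i <- r | P i) fcoef (F i) m.
Proof. by elim/big_rec2: _ => //= i x y _ <-. Qed.

Lemma fcoef0M f g : fcoef (f * g) 0%MM = fcoef f 0%MM * fcoef g 0%MM.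
Proof.
rewrite (@fcoef_mul 1) ?mdeg0 // (mcoeff0_is_multiplicative n R).1.
by rewrite !ftruncE ?mdeg0.
Qed.

(* Vanishing of all coefficients in degrees < d. *)
Definition ford d f := forall m, (mdeg m < d)%N -> fcoef f m = 0.

Lemma ford_mul a b f g : ford a f -> ford b g -> ford (a + b) (f * g).
Proof.
move=> fa gb m mab /=; rewrite big1 // => -[h1 h2] /= /eqP mE.
have [h1a|ah1] := ltnP (mdeg h1) a; first by rewrite fa // mul0r.
rewrite [fcoef g _]gb ?mulr0 //.
by rewrite -(ltn_add2l (mdeg h1)) -mdegD -mE (leq_trans mab) // leq_add2r.
Qed.

Lemma ford_sum d (I : Type) (r : seq I) (P : pred I) (F : I -> fps R n) :
  (forall i, P i -> ford d (F i)) -> ford d (\sum_(i <- r | P i) F i).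
Proof. by move=> Fd m md; rewrite fcoef_sum big1 // => i /Fd ->. Qed.

Definition fpsX (i : 'I_n) : fps R n := FPS (fun m => (m == U_(i)%MM)%:R).

Lemma fcoef0X i : fcoef (fpsX i) 0%MM = 0.
Proof. by rewrite /= eq_sym mnm1_eq0. Qed.

End FpsAlgebra.

(* Substitution f(g_0, ..., g_(n-1)), meant for g_i without constant term: then *)
(* the terms of f of degree > mdeg m do not contribute to the coefficient of    *)
(* X^m (lemma fps_substE), and fps_subst g is a morphism of algebras.           *)
Section Subst.
Variables (R : comNzRingType) (n m : nat) (g : 'I_n -> fps R m).

Definition fps_subst (f : fps R n) : fps R m := FPS (fun e =>
  fcoef (\sum_(h : 'X_{1..n < (mdeg e).+1})
           fcoef f h *: \prod_(i < n) g i ^+ h i) e).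

Hypothesis g0 : forall i, fcoef (g i) 0%MM = 0.

Let E : {mpoly R[n]} -> fps R m := mmap (in_alg (fps R m)) g.

Lemma ford_mon (h : 'X_{1..n}) : ford (mdeg h) (\prod_(i < n) g i ^+ h i).
Proof.
rewrite mdegE; elim/big_rec2: _ => [//|i d x _ xd].
apply: ford_mul xd; elim: (h i) => [//|j IH].
rewrite exprS -add1n; apply: ford_mul IH => e.
by rewrite ltnS leqn0 mdeg_eq0 => /eqP ->.
Qed.

Lemma fps_evalE d (f : fps R n) :
  E (ftrunc d f) = \sum_(h : 'X_{1..n < d}) fcoef f h *: \prod_(i < n) g i ^+ h i.
Proof.
rewrite /E /ftrunc raddf_sum /=; apply: eq_bigr => h _.
by rewrite mmapZ mmapX mulr_algl.
Qed.

Lemma ford_eval d (p : {mpoly R[n]}) :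
  (forall h, (mdeg h < d)%N -> p@_h = 0) -> ford d (E p).
Proof.
move=> pd; rewrite /E /mmap; apply: ford_sum => h _ /= e ed.
rewrite mulr_algl fcoefZ; have [/pd ->|dh] := ltnP (mdeg h) d.
  by rewrite mul0r.
by rewrite (ford_mon (leq_trans ed dh)) mulr0.
Qed.

Lemma fps_evalB d (p p' : {mpoly R[n]}) (e : 'X_{1..m}) :
    (forall h, (mdeg h < d)%N -> p@_h = p'@_h) ->
  (mdeg e < d)%N -> fcoef (E p) e = fcoef (E p') e.
Proof.
move=> pp' ed; apply/eqP; rewrite -subr_eq0; apply/eqP.
have := @ford_eval d (p - p'); rewrite /E raddfB /=; apply=> // h hd.
by rewrite mcoeffB pp' // subrr.
Qed.

Lemma fps_substE d f e : (mdeg e < d)%N ->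
  fcoef (fps_subst f) e = fcoef (E (ftrunc d f)) e.
Proof.
move=> ed; rewrite /= -fps_evalE; apply: (@fps_evalB (mdeg e).+1) => // h hd.
by rewrite !ftruncE // (leq_trans hd).
Qed.

Definition fps_subst_morph of (forall i, fcoef (g i) 0%MM = 0) := fps_subst.
Local Notation S := (fps_subst_morph g0).

Lemma fps_subst_is_linear : linear S.
Proof.
move=> a f f'; apply/fpsP => e; rewrite fcoefD fcoefZ !(fps_substE _ (ltnSn _)).
rewrite -fcoefZ -fcoefD !fps_evalE; congr fcoef.
rewrite scaler_sumr -big_split /=; apply: eq_bigr => h _.
by rewrite scalerA -scalerDl.
Qed.

Lemma fps_subst_is_monoid_morphism : monoid_morphism S.
Proof.
split=> [|f f']; apply/fpsP => e.
  rewrite (fps_substE _ (ltnSn _)) -(rmorph1 (mmap (in_alg (fps R m)) g)).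
  by apply: (@fps_evalB (mdeg e).+1) => // h hd; rewrite ftruncE // mcoeff1.
rewrite (fps_substE _ (ltnSn _)).
rewrite [RHS](fcoef_mul _ _ (ltnSn _)).
rewrite (@mcoeffM_low _ _ (mdeg e).+1 _ (ftrunc (mdeg e).+1 (E (ftrunc (mdeg e).+1 f)))
   _ (ftrunc (mdeg e).+1 (E (ftrunc (mdeg e).+1 f')))) //; last 2 first.
- by move=> h hd; rewrite !ftruncE // (fps_substE _ hd).
- by move=> h hd; rewrite !ftruncE // (fps_substE _ hd).
rewrite -fcoef_mul //; set x := ftrunc _ f; set x' := ftrunc _ f'.
transitivity (fcoef (E x * E x') e); last by []; rewrite /E -rmorphM /=.
by apply: (@fps_evalB (mdeg e).+1) => // h hd; rewrite ftruncM.
Qed.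

HB.instance Definition _ :=
  GRing.isLinear.Build R (fps R n) (fps R m) *:%R S fps_subst_is_linear.
HB.instance Definition _ :=
  GRing.isMonoidMorphism.Build (fps R n) (fps R m) S fps_subst_is_monoid_morphism.

Lemma fps_substX i : S (fpsX R i) = g i.
Proof.
apply/fpsP => e; rewrite (fps_substE _ (ltnSn _)).
rewrite -[RHS](_ : fcoef (E 'X_i) e = _); last by rewrite /E mmapX mmap1U.
apply: (@fps_evalB (mdeg e).+1) => // h hd.
by rewrite ftruncE // mcoeffX eq_sym.
Qed.

Lemma ford_subst d f : ford d f -> ford d (fps_subst f).
Proof.
move=> fd e ed; rewrite (fps_substE _ ed); apply: ford_eval ed => h hd.
by rewrite ftruncE // fd.
Qed.

End Subst.

Lemma fps_subst_comp (R : comNzRingType) (n m l : nat)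
    (g : 'I_n -> fps R m) (h : 'I_m -> fps R l)
    (g0 : forall i, fcoef (g i) 0%MM = 0) (h0 : forall i, fcoef (h i) 0%MM = 0) f :
  fps_subst_morph h0 (fps_subst_morph g0 f)
    = fps_subst (fun i => fps_subst_morph h0 (g i)) f.
Proof.
apply/fpsP => e; set d := (mdeg e).+1.
pose x : fps R m :=
  \sum_(a : 'X_{1..n < d}) fcoef f a *: \prod_(i < n) g i ^+ a i.
have -> : fcoef (fps_subst_morph h0 (fps_subst_morph g0 f)) e
    = fcoef (fps_subst_morph h0 x) e.
  apply/eqP; rewrite -subr_eq0; apply/eqP.
  have /(ford_subst h0) : ford d (fps_subst_morph g0 f - x).
    move=> b bd; rewrite (fcoef_is_zmod_morphism b) (fps_substE g0 _ bd).
    by rewrite fps_evalE subrr.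
  by rewrite -/(fps_subst_morph h0 _) raddfB /=; apply.
rewrite /x raddf_sum /=; congr fcoef; apply: eq_bigr => a _.
rewrite linearZ rmorph_prod; congr (_ *: _); apply: eq_bigr => i _.
by rewrite rmorphXn.
Qed.

Section Ideals.
Variable R : comNzRingType.

Definition ideal_gen (r : seq R) : {pred R} :=
  fun x => `[< exists c : nat -> R, x = \sum_(i < size r) c i * r`_i >].

Lemma ideal_genP r x :
  reflect (exists c : nat -> R, x = \sum_(i < size r) c i * r`_i) (x \in ideal_gen r).
Proof. exact: asboolP. Qed.

Lemma mem_ideal_gen r x : x \in r -> x \in ideal_gen r.
Proof.
move=> xr; apply/ideal_genP; exists (fun i => (i == index x r)%:R).
have ir : (index x r < size r)%N by rewrite index_mem.
rewrite (bigD1 (Ordinal ir)) //= eqxx mul1r nth_index // big1 ?addr0 // => i.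
by rewrite -val_eqE /= => /negPf ->; rewrite mul0r.
Qed.

Lemma ideal_gen_closed r : 1 \notin ideal_gen r -> idealr_closed (ideal_gen r).
Proof.
move=> r1; split=> // [|a x y /ideal_genP[c ->] /ideal_genP[d ->]].
  by apply/ideal_genP; exists (fun=> 0); rewrite big1 // => i _; rewrite mul0r.
apply/ideal_genP; exists (fun i => a * c i + d i).
by rewrite mulr_sumr -big_split /=; apply: eq_bigr => i _; rewrite mulrA mulrDl.
Qed.

Lemma ideal_gen_ker (S : comNzRingType) (f : {rmorphism R -> S}) r :
  {in r, forall x, f x = 0} -> forall x, x \in ideal_gen r -> f x = 0.
Proof.
move=> fr x /ideal_genP[c ->]; rewrite rmorph_sum big1 // => i _.
by rewrite rmorphM (fr r`_i) ?mulr0 ?mem_nth.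
Qed.

End Ideals.

Lemma fps_ideal1 (R : comNzRingType) n (r : seq (fps R n)) :
  {in r, forall x, fcoef x 0%MM = 0} -> 1 \notin ideal_gen r.
Proof.
move=> r0; apply/negP => /ideal_genP[c] /fpsP/(_ 0%MM).
rewrite fcoef_sum big1 => [|i _]; last by rewrite fcoef0M (r0 r`_i) ?mulr0 ?mem_nth.
by rewrite /= eqxx => /eqP; rewrite oner_eq0.
Qed.

Section QuotientAlgebra.
Variables (k : comNzRingType) (R : comAlgType k) (I : idealr R).
Local Notation Q := {ideal_quot I}.

Definition quot_scale (a : k) (x : Q) : Q := \pi_Q (a%:A) * x.

Fact quot_scaleA a b x : quot_scale a (quot_scale b x) = quot_scale (a * b) x.
Proof. by rewrite /quot_scale mulrA -rmorphM /= mulr_algl scalerA. Qed.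
Fact quot_scale1 : left_id 1 quot_scale.
Proof. by move=> x; rewrite /quot_scale scale1r rmorph1 mul1r. Qed.
Fact quot_scaleDr : right_distributive quot_scale +%R.
Proof. by move=> a x y; rewrite /quot_scale mulrDr. Qed.
Fact quot_scaleDl x : {morph quot_scale^~ x : a b / a + b}.
Proof. by move=> a b; rewrite /quot_scale scalerDl rmorphD mulrDl. Qed.

HB.instance Definition _ := GRing.Zmodule_isLmodule.Build k (Quotient.quot I)
  quot_scaleA quot_scale1 quot_scaleDr quot_scaleDl.

Fact quot_scaleAl (a : k) (x y : Q) : a *: (x * y) = (a *: x) * y.
Proof. exact: mulrA. Qed.

HB.instance Definition _ :=
  GRing.Lmodule_isLalgebra.Build k (Quotient.quot I) quot_scaleAl.
HB.instance Definition _ := GRing.Lalgebra_isComAlgebra.Build k (Quotient.quot I).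

Definition quot_proj (x : R) : Q := \pi_Q x.

Fact quot_proj_is_linear : linear quot_proj.
Proof.
move=> a x y; rewrite /quot_proj rmorphD /=; congr (_ + _).
by rewrite -mulr_algl rmorphM.
Qed.
Fact quot_proj_is_monoid_morphism : monoid_morphism quot_proj.
Proof. by split=> [|x y]; rewrite /quot_proj (rmorph1, rmorphM). Qed.
HB.instance Definition _ :=
  GRing.isLinear.Build k R Q *:%R quot_proj quot_proj_is_linear.
HB.instance Definition _ :=
  GRing.isMonoidMorphism.Build R Q quot_proj quot_proj_is_monoid_morphism.

Lemma quot_proj_eq0 x : (quot_proj x == 0) = (x \in I).
Proof. by rewrite -[x in RHS]subr0 Quotient.idealrBE -(rmorph0 quot_proj). Qed.

Lemma quot_projP (x : Q) : exists y, x = quot_proj y.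
Proof. by exists (repr x); rewrite /quot_proj reprK. Qed.

Section Lift.
Variables (S : comAlgType k) (f : {lrmorphism R -> S}).
Hypothesis fI : forall x, x \in I -> f x = 0.

Definition quot_lift of (forall x, x \in I -> f x = 0) :=
  fun x : Q => f (repr x).
Local Notation F := (quot_lift fI).

Lemma quot_liftE x : F (quot_proj x) = f x.
Proof.
apply/eqP; rewrite /quot_lift -subr_eq0 -raddfB; apply/eqP/fI.
by rewrite Quotient.idealrBE reprK.
Qed.

Fact quot_lift_is_linear : linear F.
Proof.
move=> a x y; have [x' ->] := quot_projP x; have [y' ->] := quot_projP y.
by rewrite -linearP !quot_liftE linearP.
Qed.
Fact quot_lift_is_monoid_morphism : monoid_morphism F.
Proof.
split=> [|x y]; first by rewrite -(rmorph1 quot_proj) quot_liftE rmorph1.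
have [x' ->] := quot_projP x; have [y' ->] := quot_projP y.
by rewrite -rmorphM !quot_liftE rmorphM.
Qed.
HB.instance Definition _ := GRing.isLinear.Build k Q S *:%R F quot_lift_is_linear.
HB.instance Definition _ :=
  GRing.isMonoidMorphism.Build Q S F quot_lift_is_monoid_morphism.
End Lift.

End QuotientAlgebra.

Section DiagonalAction.
Variables (k : fieldType) (p s : nat) (chp : p \in [pchar k]).
Variables mu mu' : nat -> k.
Local Notation q := (p ^ s)%N.

(* Only nu_2, ..., nu_q matter. *)
Definition unit_slope_poly (q : nat) (nu : nat -> k) : {poly k} :=
  'X + \sum_(2 <= i < q.+1) nu i *: 'X^i.

Local Notation P := (unit_slope_poly q mu).
Local Notation Q := (unit_slope_poly q mu').

Definition ps_u : fps k 4 := fpsX k (@Ordinal 4 0 isT).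
Definition ps_w : fps k 4 := fpsX k (@Ordinal 4 1 isT).
Definition ps_u' : fps k 4 := fpsX k (@Ordinal 4 2 isT).
Definition ps_w' : fps k 4 := fpsX k (@Ordinal 4 3 isT).

Definition ps_a : fps k 3 := fpsX k (@Ordinal 3 0 isT).
Definition ps_b : fps k 3 := fpsX k (@Ordinal 3 1 isT).
Definition ps_c : fps k 3 := fpsX k (@Ordinal 3 2 isT).

Definition relsA : seq (fps k 4) :=
  [:: ps_u ^+ q - ps_u * ps_w ^+ q.-1 - horner_alg ps_w P;
      ps_u' ^+ q - ps_u' * ps_w' ^+ q.-1 - horner_alg ps_w' Q].

Definition relsB : seq (fps k 3) :=
  [:: ps_c ^+ q - (ps_a * ps_b) ^+ q.-1 * ps_c
      - ps_a ^+ q * horner_alg ps_b Q + ps_b ^+ q * horner_alg ps_a P].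

(* The proof argument makes q a power of the characteristic, which is what the *)
(* properness of the ideals and the well-definedness of the action rely on.    *)
Definition idealA of p \in [pchar k] : {pred fps k 4} := ideal_gen relsA.
Definition idealB of p \in [pchar k] : {pred fps k 3} := ideal_gen relsB.

Fact q_gt0 : (0 < q)%N.
Proof. by rewrite expn_gt0 prime_gt0 ?(pcharf_prime chp). Qed.

Lemma horner_alg_unit_slope (A : comAlgType k) (x : A) (n : nat) (nu : nat -> k) :
  horner_alg x (unit_slope_poly n nu)
    = x + \sum_(2 <= i < n.+1) nu i *: x ^+ i.
Proof.
rewrite rmorphD /= horner_algX rmorph_sum /=.
apply: (congr1 (+%R x)).
by apply: eq_bigr => i _; rewrite linearZ /= mulr_algl rmorphXn /= horner_algX.
Qed.

Lemma lrmorph_horner_alg (A B : comAlgType k) (f : {lrmorphism A -> B}) (x : A)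
    (n : nat) (nu : nat -> k) :
  f (horner_alg x (unit_slope_poly n nu))
    = horner_alg (f x) (unit_slope_poly n nu).
Proof.
rewrite !horner_alg_unit_slope raddfD raddf_sum /=.
by apply: (congr1 (+%R (f x))); apply: eq_bigr => i _; rewrite linearZ /= rmorphXn.
Qed.

Let fcoef0Ml (n : nat) (f g : fps k n) : fcoef f 0%MM = 0 ->
  fcoef (f * g) 0%MM = 0.
Proof. by move=> f0; rewrite fcoef0M f0 mul0r. Qed.

Let fcoef0Xn (n : nat) (f : fps k n) j : fcoef f 0%MM = 0 -> (0 < j)%N ->
  fcoef (f ^+ j) 0%MM = 0.
Proof. by case: j => // j f0 _; rewrite exprS fcoef0Ml. Qed.

Let fcoef0_horner (n : nat) (f : fps k n) (j : nat) nu : fcoef f 0%MM = 0 ->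
  fcoef (horner_alg f (unit_slope_poly j nu)) 0%MM = 0.
Proof.
move=> f0; rewrite horner_alg_unit_slope fcoefD f0 add0r fcoef_sum.
rewrite big_nat_cond big1 // => i /andP[/andP[i2 _] _].
by rewrite fcoefZ fcoef0Xn ?mulr0 // ltnW.
Qed.

Let fcoefB (n : nat) (f g : fps k n) m : fcoef (f - g) m = fcoef f m - fcoef g m.
Proof. by []. Qed.

Fact idealA_closed : idealr_closed (idealA chp).
Proof.
have c0 : forall i, fcoef (fpsX k i : fps k 4) 0%MM = 0 by apply: fcoef0X.
apply/ideal_gen_closed/fps_ideal1 => x; rewrite !inE => /orP[]/eqP->;
  by rewrite !fcoefB fcoef0Xn ?fcoef0Ml ?fcoef0_horner ?c0 ?q_gt0 // !subr0.
Qed.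
HB.instance Definition _ := isIdealr.Build (fps k 4) (idealA chp) idealA_closed.

Fact idealB_closed : idealr_closed (idealB chp).
Proof.
apply/ideal_gen_closed/fps_ideal1 => x; rewrite !inE => /eqP->.
have c0 : forall i, fcoef (fpsX k i : fps k 3) 0%MM = 0 by apply: fcoef0X.
rewrite fcoefD !fcoefB [_ ^+ q.-1 * _]mulrC fcoef0Xn ?c0 ?q_gt0 //.
by rewrite !fcoef0Ml ?fcoef0Xn ?c0 ?q_gt0 // !subr0 addr0.
Qed.
HB.instance Definition _ := isIdealr.Build (fps k 3) (idealB chp) idealB_closed.

Definition ringA := {ideal_quot (idealA chp)}.
Definition ringB := {ideal_quot (idealB chp)}.
HB.instance Definition _ := GRing.ComAlgebra.on ringA.
HB.instance Definition _ := GRing.ComAlgebra.on ringB.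
Definition projA : fps k 4 -> ringA := @quot_proj k (fps k 4) (idealA chp).
Definition projB : fps k 3 -> ringB := @quot_proj k (fps k 3) (idealB chp).
HB.instance Definition _ := GRing.LRMorphism.on projA.
HB.instance Definition _ := GRing.LRMorphism.on projB.

(* F_q inside k: the roots of X^q - X. *)
Definition Fq := {l : k | l ^+ q == l}.

Definition act_vars (l : k) (i : 'I_4) : fps k 4 :=
  [:: ps_u + l *: ps_w; ps_w; ps_u' + l *: ps_w'; ps_w']`_i.

Fact act_vars0 l i : fcoef (act_vars l i) 0%MM = 0.
Proof.
have c0 : forall i, fcoef (fpsX k i : fps k 4) 0%MM = 0 by apply: fcoef0X.
apply/eqP/(@all_nthP _ (fun f => fcoef f 0%MM == 0)); last exact: ltn_ord.
by rewrite /all !fcoefD !fcoefZ !c0 mulr0 addr0 eqxx.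
Qed.

Definition ps_act (l : k) : fps k 4 -> fps k 4 := fps_subst_morph (act_vars0 l).
HB.instance Definition _ l := GRing.LRMorphism.on (ps_act l).

Lemma ps_act_u l : ps_act l ps_u = ps_u + l *: ps_w.
Proof. exact: fps_substX. Qed.
Lemma ps_act_w l : ps_act l ps_w = ps_w.
Proof. exact: fps_substX. Qed.
Lemma ps_act_u' l : ps_act l ps_u' = ps_u' + l *: ps_w'.
Proof. exact: fps_substX. Qed.
Lemma ps_act_w' l : ps_act l ps_w' = ps_w'.
Proof. exact: fps_substX. Qed.

Lemma pchar_fps n : p \in [pchar fps k n].
Proof. exact: (rmorph_pchar (in_alg (fps k n))). Qed.

Lemma fps_exprDq n (x y : fps k n) : (x + y) ^+ q = x ^+ q + y ^+ q.
Proof.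
apply: exprDn_pchar; rewrite (eq_pnat _ (pcharf_eq (pchar_fps n))).
by rewrite pnatX pnat_id // (pcharf_prime chp).
Qed.

Lemma fps_exprBq n (x y : fps k n) : (x - y) ^+ q = x ^+ q - y ^+ q.
Proof. by apply/eqP; rewrite eq_sym subr_eq -fps_exprDq subrK. Qed.

Lemma ps_act_rels (l : Fq) : {in relsA, forall x, ps_act (val l) x = x}.
Proof.
have rel (x y : fps k 4) : (x + val l *: y) ^+ q - (x + val l *: y) * y ^+ q.-1
    = x ^+ q - x * y ^+ q.-1.
  rewrite fps_exprDq exprZn (eqP (valP l)) mulrDl -scalerAl -exprS.
  by rewrite (prednK q_gt0) opprD addrACA subrr addr0.
move=> x; rewrite !inE => /orP[]/eqP->;
  rewrite !rmorphB !rmorphM !rmorphXn /= lrmorph_horner_alg /=.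
- by rewrite ps_act_u ps_act_w rel.
- by rewrite ps_act_u' ps_act_w' rel.
Qed.

Fact act_ker (l : Fq) : forall x, x \in idealA chp ->
  (projA \o ps_act (val l)) x = 0.
Proof.
apply: ideal_gen_ker => x xr /=; rewrite ps_act_rels //.
by apply/eqP; rewrite quot_proj_eq0; apply: mem_ideal_gen.
Qed.

Definition act (l : Fq) : ringA -> ringA := quot_lift (act_ker l).
HB.instance Definition _ l := GRing.LRMorphism.on (act l).

Lemma act_proj l f : act l (projA f) = projA (ps_act (val l) f).
Proof. exact: quot_liftE. Qed.

Definition invariant : {pred ringA} := fun x => `[< forall l : Fq, act l x = x >].

Lemma invariantP x : reflect (forall l : Fq, act l x = x) (x \in invariant).
Proof. exact: asboolP. Qed.

Fact invariant_subalg_closed : subalg_closed invariant.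
Proof.
split=> [|a x y /invariantP xi /invariantP yi|x y /invariantP xi /invariantP yi];
  apply/invariantP => l.
- exact: rmorph1.
- by rewrite linearP /= xi yi.
- by rewrite rmorphM /= xi yi.
Qed.
HB.instance Definition _ :=
  GRing.isSubalgClosed.Build k ringA invariant invariant_subalg_closed.

Record invRing := InvRing { invRing_val : ringA; _ : invRing_val \in invariant }.
HB.instance Definition _ := [isSub for invRing_val].
HB.instance Definition _ := [Choice of invRing by <:].
HB.instance Definition _ := [SubChoice_isSubAlgebra of invRing by <:].
HB.instance Definition _ := [SubNzRing_isSubComNzRing of invRing by <:].

(* The values at a, b, c, lifted to k[[u, w, u', w']]. *)
Definition hom_vars (i : 'I_3) : fps k 4 :=
  [:: ps_w; ps_w'; ps_w * ps_u' - ps_w' * ps_u]`_i.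

Fact hom_vars0 i : fcoef (hom_vars i) 0%MM = 0.
Proof.
have c0 : forall i, fcoef (fpsX k i : fps k 4) 0%MM = 0 by apply: fcoef0X.
apply/eqP/(@all_nthP _ (fun f => fcoef f 0%MM == 0)); last exact: ltn_ord.
by rewrite /all !fcoefB !fcoef0Ml ?c0 // subrr eqxx.
Qed.

Definition ps_hom : fps k 3 -> fps k 4 := fps_subst_morph hom_vars0.
HB.instance Definition _ := GRing.LRMorphism.on ps_hom.

Lemma ps_hom_a : ps_hom ps_a = ps_w.
Proof. exact: fps_substX. Qed.
Lemma ps_hom_b : ps_hom ps_b = ps_w'.
Proof. exact: fps_substX. Qed.
Lemma ps_hom_c : ps_hom ps_c = ps_w * ps_u' - ps_w' * ps_u.
Proof. exact: fps_substX. Qed.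

Lemma ps_hom_invariant f : projA (ps_hom f) \in invariant.
Proof.
apply/invariantP => l; rewrite act_proj; congr projA.
rewrite /ps_act /ps_hom fps_subst_comp; congr fps_subst; apply/funext => i.
rewrite -/(ps_act (val l)).
case: i => [[|[|[|//]]] ?]; [exact: ps_act_w | exact: ps_act_w' |].
transitivity (ps_act (val l) (ps_w * ps_u' - ps_w' * ps_u)); first by [].
transitivity (ps_w * ps_u' - ps_w' * ps_u); last by [].
rewrite rmorphB !rmorphM /= ps_act_w ps_act_w' ps_act_u ps_act_u'.
by rewrite !mulrDr -!scalerAr [ps_w' * ps_w]mulrC opprD addrACA subrr addr0.
Qed.

Definition ps_hom_inv (f : fps k 3) : invRing := InvRing (ps_hom_invariant f).

Fact ps_hom_inv_is_linear : linear ps_hom_inv.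
Proof. by move=> a f g; apply/val_inj; rewrite /= !linearP. Qed.
Fact ps_hom_inv_is_monoid_morphism : monoid_morphism ps_hom_inv.
Proof. by split=> [|f g]; apply/val_inj; rewrite /= ?rmorph1 ?rmorphM. Qed.
HB.instance Definition _ := GRing.isLinear.Build k (fps k 3) invRing *:%R
  ps_hom_inv ps_hom_inv_is_linear.
HB.instance Definition _ := GRing.isMonoidMorphism.Build (fps k 3) invRing
  ps_hom_inv ps_hom_inv_is_monoid_morphism.

Fact hom_ker : forall x, x \in idealB chp -> ps_hom_inv x = 0.
Proof.
apply: ideal_gen_ker => x; rewrite inE => /eqP->; apply/val_inj => /=.
have rA i : (i < 2)%N -> projA relsA`_i = 0.
  by move=> i2; apply/eqP; rewrite quot_proj_eq0; apply/mem_ideal_gen/mem_nth.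
transitivity (projA (ps_w ^+ q) * projA relsA`_1
    - projA (ps_w' ^+ q) * projA relsA`_0); last by rewrite !rA // !mulr0 subr0.
rewrite -!rmorphM -rmorphB; congr projA.
rewrite rmorphD !rmorphB !rmorphM !rmorphXn /=.
rewrite !lrmorph_horner_alg !rmorphM /= ps_hom_a ps_hom_b ps_hom_c.
have qE (y : fps k 4) : y ^+ q = y * y ^+ q.-1 by rewrite -exprS (prednK q_gt0).
rewrite fps_exprBq !exprMn (qE ps_w) (qE ps_w').
move: (ps_u ^+ q) (ps_u' ^+ q) (ps_w ^+ q.-1) (ps_w' ^+ q.-1).
move: (horner_alg ps_w P) (horner_alg ps_w' Q) => Pw Qw' Uq U'q Wq W'q.
ring.
Qed.

Definition quot_hom : ringB -> invRing := quot_lift hom_ker.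
HB.instance Definition _ := GRing.LRMorphism.on quot_hom.

Lemma quot_homE f : invRing_val (quot_hom (projB f)) = projA (ps_hom f).
Proof. by rewrite [quot_hom _]quot_liftE. Qed.

End DiagonalAction.

Arguments quot_hom {k p} s chp mu mu' _.

(* Main.v *)
From HB Require Import structures.
Require Import Defs.
From mathcomp Require Import all_boot all_order all_algebra.
From mathcomp Require Import separable mpoly boolp.
From mathcomp Require Import ring zify.

(** Everything takes place on normal forms inside power series rings.

    The relations u^q = u w^(q-1) + P(w) and u'^q = u' w'^(q-1) + Q(w') are monic
    in u and u', and their lower coefficients are series in w or w' without
    constant term. By Weierstrass division ([weierstrass_div],
    [weierstrass_uniq]) every element of A is represented by exactly one series of degree less than q in u and in u'
    ([idealA_reduce], [idealA_bounded]); in the same way every element of the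
    source is represented by a series of degree less than q in c
    ([idealB_reduce]). Both the action of G, u |-> u + l w, and the map
    c |-> w u' - w' u send such series to such series ([bounded_act],
    [bounded_hom]). So it is enough to prove, in k[[u, w, u', w']] and without
    the relations, that the map is injective on series of degree less than q in
    c, and that its image contains every invariant series of degree less than q
    in u and in u'.

    The action and the map respect the bidegree given by the degree in (u, w) and
    the degree in (u', w'). Dehomogenizing by t = u / w and t' = u' / w' turns the
    component of bidegree (a, b) of an invariant series into a polynomial
    F(t, t'), of degree less than q in each variable, with
    F(t + l, t' + l) = F(t, t') for the q elements l of G. At t = 0 this says
    that F(l, y) = F(0, y - l). Two polynomials in l of degree less than q that
    agree at q points are equal, so F(t, t') = G(t' - t) with G(y) = F(0, y). As F
    has degree at most a in t and at most b in t', G has degree at most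
    min(a, b); and w w' (t' - t) = w u' - w' u, so that w^a w'^b G(t' - t) is a
    polynomial in w, w' and w u' - w' u ([invariant_hom]). *)

Set Implicit Arguments.
Unset Strict Implicit.
Unset Printing Implicit Defensive.

Import GRing.Theory.
Local Open Scope ring_scope.

(** * Supports, partial degrees and monomials *)

Section Supports.
Variables (R : comNzRingType) (n : nat).
Implicit Types (f g : fps R n) (e h : 'X_{1..n}) (i : 'I_n).

Lemma fcoefB f g e : fcoef (f - g) e = fcoef f e - fcoef g e.
Proof. by []. Qed.

Lemma fcoef_mul_neq0 f g e : fcoef (f * g) e != 0 ->
  exists h1 h2, [/\ e = (h1 + h2)%MM, fcoef f h1 != 0 & fcoef g h2 != 0].
Proof.
move=> fge; apply: contrapT => no; case/eqP: fge => /=.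
apply: big1 => -[h1 h2] /= /eqP eE; apply: contrapT => /eqP nz; apply: no.
exists h1, h2; split=> //; apply: contraNneq nz => ->; by rewrite ?mul0r ?mulr0.
Qed.

Definition fmon h : fps R n := FPS (fun e => (e == h)%:R).

Lemma fcoef_fmonM h f e :
  fcoef (fmon h * f) e = if (h <= e)%MM then fcoef f (e - h)%MM else 0.
Proof.
case: ifPn => [he|nhe]; last first.
  apply: contraNeq nhe => /fcoef_mul_neq0[h1 [h2 [-> /= + _]]].
  by have [-> _|] := eqVneq h1 h; rewrite ?lem_addr ?eqxx.
have h1P : (mdeg h < (mdeg e).+1)%N.
  by rewrite ltnS -(submK he) mdegD leq_addl.
have h2P : (mdeg (e - h)%MM < (mdeg e).+1)%N.
  by rewrite ltnS -{2}(submK he) mdegD leq_addr.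
rewrite /= (bigD1 (BMultinom h1P, BMultinom h2P)) /=; last first.
  by rewrite addmC submK.
rewrite eqxx mul1r big1 ?addr0 // => -[x y] /= /andP[/eqP eE xy].
have [xh|] := eqVneq (x : 'X_{1..n}) h; last by rewrite mul0r.
case/eqP: xy; congr (_, _); apply/val_inj => //=.
by rewrite [X in (X - _)%MM]eE xh addmC addmK.
Qed.

Lemma fmonM h1 h2 : fmon h1 * fmon h2 = fmon (h1 + h2)%MM.
Proof.
apply/fpsP => e; rewrite fcoef_fmonM /=; case: ifP => [he|/negbT nhe].
  by rewrite -(eqm_add2l h1) [(h1 + (e - h1))%MM]addmC submK.
by case: eqP nhe => // ->; rewrite lem_addr.
Qed.

Lemma fmonX h d : fmon h ^+ d = fmon (h *+ d)%MM.
Proof.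
elim: d => [|d IH]; first by rewrite expr0 mulm0n.
by rewrite exprS IH fmonM mulmS.
Qed.

Lemma fmon_prod (J : finType) (c : J -> R) (h : J -> 'X_{1..n}) :
  \prod_j (c j *: fmon (h j)) = (\prod_j c j) *: fmon (\sum_j h j)%MM.
Proof.
elim/big_rec3: _ => [|j h' a x _ ->]; first by rewrite scale1r.
by rewrite -scalerAl -scalerAr scalerA fmonM.
Qed.

Lemma fpsX_mon i : fpsX R i = fmon U_(i).
Proof. by []. Qed.

Definition degX_le i d f := forall e, fcoef f e != 0 -> (e i <= d)%N.

Lemma degX_leW i d d' f : (d <= d')%N -> degX_le i d f -> degX_le i d' f.
Proof. by move=> dd' fd e /fd /leq_trans; apply. Qed.

Lemma degX_leB i d f g : degX_le i d f -> degX_le i d g -> degX_le i d (f - g).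
Proof.
move=> fd gd e; rewrite fcoefB; have [->|/fd //] := eqVneq (fcoef f e) 0.
by rewrite sub0r oppr_eq0 => /gd.
Qed.

Lemma degX_leD i d f g : degX_le i d f -> degX_le i d g -> degX_le i d (f + g).
Proof.
move=> fd gd e; rewrite fcoefD; have [->|/fd //] := eqVneq (fcoef f e) 0.
by rewrite add0r => /gd.
Qed.

Lemma degX_leZ i d a f : degX_le i d f -> degX_le i d (a *: f).
Proof. by move=> fd e; rewrite fcoefZ => afe; apply/fd/(contraNneq _ afe) => ->; rewrite mulr0. Qed.

Lemma degX_leM i d1 d2 f g :
  degX_le i d1 f -> degX_le i d2 g -> degX_le i (d1 + d2) (f * g).
Proof.
move=> fd gd e /fcoef_mul_neq0[h1 [h2 [-> /fd h1d /gd h2d]]].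
by rewrite mnmDE leq_add.
Qed.

Lemma degX_le1 i : degX_le i 0 1.
Proof. by move=> e /=; have [->|] := eqVneq e 0%MM; rewrite ?mnm0E ?eqxx. Qed.

Lemma degX_leXn i d m f : degX_le i d f -> degX_le i (d * m) (f ^+ m).
Proof.
move=> fd; elim: m => [|m IH]; first by rewrite muln0; apply: degX_le1.
by rewrite exprS mulnS; apply: degX_leM.
Qed.

Lemma degX_leX i j : degX_le i (i == j) (fpsX R j).
Proof.
by move=> e /=; have [->|] := eqVneq e U_(j)%MM; rewrite ?eqxx // mnm1E [j == i]eq_sym.
Qed.

Lemma degX_le_sum i d (I : Type) (r : seq I) (P : pred I) (F : I -> fps R n) :
  (forall j, P j -> degX_le i d (F j)) ->
  degX_le i d (\sum_(j <- r | P j) F j).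
Proof.
move=> Fd; elim/big_rec: _ => [e|j x Pj xd]; first by rewrite eqxx.
by apply: degX_leD => //; apply: Fd.
Qed.

Lemma degX_le_prod i (J : finType) (d : J -> nat) (F : J -> fps R n) :
  (forall j, degX_le i (d j) (F j)) ->
  degX_le i (\sum_j d j) (\prod_j F j).
Proof.
move=> Fd; elim/big_rec2: _ => [|j x y _ xd]; first exact: degX_le1.
exact: degX_leM.
Qed.

Definition truncX i d f : fps R n :=
  FPS (fun e => if (e i <= d)%N then fcoef f e else 0).

Lemma truncX_deg i d f : degX_le i d (truncX i d f).
Proof. by move=> e /=; case: ifP; rewrite ?eqxx. Qed.

Lemma truncX_id i d f : degX_le i d f -> truncX i d f = f.
Proof.
move=> fd; apply/fpsP => e /=; case: ifPn => // ed; apply/esym/eqP.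
exact: (contraNT (fd e)).
Qed.

Lemma truncXB i d f g : truncX i d (f - g) = truncX i d f - truncX i d g.
Proof. by apply/fpsP => e; rewrite fcoefB /=; case: ifP; rewrite ?subrr. Qed.

Lemma degX_le_trunc i j d d' f : degX_le j d f -> degX_le j d (truncX i d' f).
Proof. by move=> fd e /=; case: ifP => [_ /fd|]; rewrite ?eqxx. Qed.

(** Multiplication by a series in which [X_i] does not occur leaves the exponent
    of [X_i] in each term unchanged. *)
Lemma truncXM i d f g : degX_le i 0 f -> truncX i d (f * g) = f * truncX i d g.
Proof.
move=> f0; apply/fpsP => e /=; rewrite -mulrb -mulr_natl mulr_sumr.
apply: eq_bigr => -[h1 h2] /= /eqP/(congr1 (fun m : 'X_{1..n} => m i)).
rewrite /= mnmDE => ->.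
have [->|/f0] := eqVneq (fcoef f h1) 0; first by rewrite !mul0r mulr0.
rewrite leqn0 => /eqP h10; rewrite h10 add0n.
by case: ifP; rewrite ?mul1r ?mul0r ?mulr0.
Qed.

End Supports.

(** * Weierstrass division by [X_i ^+ q - h] *)

Section WeierstrassDivision.
Variables (R : comNzRingType) (n : nat) (i : 'I_n).
Implicit Types (f g h Q : fps R n) (e : 'X_{1..n}).

Definition wt_off e : nat := \sum_(j < n | j != i) e j.

Definition ord_off d f := forall e, fcoef f e != 0 -> (d <= wt_off e)%N.

Lemma wt_offD e1 e2 : wt_off (e1 + e2) = (wt_off e1 + wt_off e2)%N.
Proof. by rewrite -big_split; apply: eq_bigr => j _; rewrite mnmDE. Qed.

Lemma ord_offW d d' f : (d <= d')%N -> ord_off d' f -> ord_off d f.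
Proof. by move=> dd' fd e /fd; apply: leq_trans. Qed.

Lemma ord_offD d f g : ord_off d f -> ord_off d g -> ord_off d (f + g).
Proof.
move=> fd gd e; rewrite fcoefD; have [->|/fd //] := eqVneq (fcoef f e) 0.
by rewrite add0r => /gd.
Qed.

Lemma ord_offN d f : ord_off d f -> ord_off d (- f).
Proof. by move=> fd e; rewrite oppr_eq0 => /fd. Qed.

Lemma ord_offM a b f g : ord_off a f -> ord_off b g -> ord_off (a + b) (f * g).
Proof.
move=> fa gb e /fcoef_mul_neq0[e1 [e2 [-> /fa e1a /gb e2b]]].
by rewrite wt_offD leq_add.
Qed.

Lemma ord_offX j : j != i -> ord_off 1 (fpsX R j).
Proof.
move=> ji e /=; have [-> _|] := eqVneq e U_(j)%MM; last by rewrite eqxx.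
by rewrite /wt_off (bigD1 j) //= mnm1E eqxx.
Qed.

Lemma ord_offXn d f : ord_off 1 f -> (0 < d)%N -> ord_off 1 (f ^+ d).
Proof.
case: d => // d f1 _; rewrite exprS (_ : 1%N = (1 + 0)%N) //.
exact: ord_offM.
Qed.

Lemma ord_off_sum d (I : Type) (r : seq I) (P : pred I) (F : I -> fps R n) :
  (forall j, P j -> ord_off d (F j)) -> ord_off d (\sum_(j <- r | P j) F j).
Proof.
move=> Fd; elim/big_rec: _ => [e|j x Pj xd]; first by rewrite eqxx.
by apply: ord_offD => //; apply: Fd.
Qed.

(** The filtration by the degree off [X_i] is separated: a coefficient has one
    fixed such degree. *)
Lemma ord_off_eq f g : (forall d, ord_off d (f - g)) -> f = g.
Proof.
move=> fg; apply/fpsP => e; apply/eqP; rewrite -subr_eq0 -fcoefB.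
by apply: contraT => /(fg (wt_off e).+1); rewrite ltnn.
Qed.

Variable q : nat.

Definition quotXn f : fps R n := FPS (fun e => fcoef f (e + U_(i) *+ q)%MM).

Lemma quotXnB f g : quotXn (f - g) = quotXn f - quotXn g.
Proof. by []. Qed.

Lemma quotXn_mul f : quotXn (fpsX R i ^+ q * f) = f.
Proof.
apply/fpsP => e; rewrite fpsX_mon fmonX [LHS]fcoef_fmonM lem_addl.
by rewrite addmK.
Qed.

Lemma quotXn_ord d f : ord_off d f -> ord_off d (quotXn f).
Proof.
move=> fd e /fd; rewrite wt_offD [X in (_ + X)%N]big1 ?addn0 // => j ji.
by rewrite mulmnE mnm1E eq_sym (negPf ji).
Qed.

Hypothesis q_gt0 : (0 < q)%N.

Lemma quotXn_deg f : degX_le i q.-1 f -> quotXn f = 0.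
Proof.
move=> fd; apply/fpsP => e /=; apply/eqP; apply: contraT => /fd.
by rewrite mnmDE mulmnE mnm1E eqxx mul1n; lia.
Qed.

Lemma quotXnP f : f = truncX i q.-1 f + fpsX R i ^+ q * quotXn f.
Proof.
apply/fpsP => e; rewrite fcoefD fpsX_mon fmonX fcoef_fmonM /=.
have -> : (U_(i) *+ q <= e)%MM = ~~ (e i <= q.-1)%N.
  apply/mnm_lepP/idP => [/(_ i)|eq j].
    by rewrite mulmnE mnm1E eqxx mul1n; lia.
  rewrite mulmnE mnm1E; case: eqP => [<-|_]; last by rewrite mul0n.
  by rewrite mul1n; lia.
case: (leqP (e i)) => //= eq; first by rewrite addr0.
rewrite add0r submK //; apply/mnm_lepP => j.
rewrite mulmnE mnm1E; case: eqP => [<-|_]; last by rewrite mul0n.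
by rewrite mul1n; lia.
Qed.

Variable h : fps R n.
Hypothesis h1 : ord_off 1 h.

(** The quotient is the fixed point of [Q |-> quotXn (f + h * Q)], which
    contracts the filtration by the degree off [X_i] because [h] has positive
    order there; the limit of the iterates is taken coefficientwise. *)
Lemma weierstrass_div f : exists Q, degX_le i q.-1 (f - (fpsX R i ^+ q - h) * Q).
Proof.
pose T Q := quotXn (f + h * Q).
have TB d Q Q' : ord_off d (Q - Q') -> ord_off d.+1 (T Q - T Q').
  move=> QQ'; rewrite -quotXnB; apply: quotXn_ord.
  by rewrite addrAC opprD addrA subrr sub0r addrC -mulrBr -add1n; apply: ord_offM.
pose Qn m := iter m T 0.
have QnS m l : ord_off m (Qn (m + l)%N - Qn m).
  by elim: m => [|m IH] //; rewrite addSn; apply: TB.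
pose Q := FPS (fun e => fcoef (Qn (wt_off e).+1) e).
have QQn m : ord_off m (Q - Qn m).
  move=> e; apply: contraNT; rewrite -ltnNge => em.
  have := QnS (wt_off e).+1 (m - (wt_off e).+1)%N e.
  rewrite subnKC // ltnn => /implyP; rewrite implybF negbK.
  by rewrite !fcoefB !subr_eq0 eq_sym.
have QT : Q = T Q.
  apply: ord_off_eq => d; apply: (@ord_offW _ d.+1) => //.
  rewrite (_ : Q - T Q = (Q - Qn d.+1) - (T Q - T (Qn d))); last first.
    by rewrite opprB addrA subrK.
  by apply/ord_offD/ord_offN/TB/QQn/QQn.
exists Q; rewrite mulrBl opprB addrA addrAC -/(f + h * Q).
rewrite [f - _ + _]addrAC [f + h * Q]quotXnP -/(T Q) -QT addrK.
exact: truncX_deg.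
Qed.

(** If [(X_i ^+ q - h) * Q] has no power [X_i ^+ q], then [Q] is a fixed point of
    the contraction [Q |-> quotXn (h * Q)], like [0]. *)
Lemma weierstrass_uniq Q : degX_le i q.-1 ((fpsX R i ^+ q - h) * Q) -> Q = 0.
Proof.
move=> /quotXn_deg; rewrite mulrBl quotXnB quotXn_mul => /eqP.
rewrite subr_eq0 => /eqP QE; apply: ord_off_eq => d; rewrite subr0.
elim: d => [|d IH] //; rewrite QE; apply: quotXn_ord.
by rewrite -add1n; apply: ord_offM.
Qed.

End WeierstrassDivision.

(** * Substitution: degrees and monomial substitutions *)

Section Substitution.
Variables (R : comNzRingType) (n m : nat).

Lemma degX_le_subst (g : 'I_n -> fps R m) (i : 'I_m) (d : 'I_n -> nat) N (f : fps R n) :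
    (forall j, degX_le i (d j) (g j)) ->
    (forall h : 'X_{1..n}, fcoef f h != 0 -> (\sum_j d j * h j <= N)%N) ->
  degX_le i N (fps_subst g f).
Proof.
move=> gd fN e /=; move: e (mdeg e).+1 => e b; move: e.
apply: degX_le_sum => h _; have [->|/fN hN] := eqVneq (fcoef f h) 0.
  by rewrite scale0r => e; rewrite eqxx.
apply/degX_leZ/(degX_leW hN)/degX_le_prod => j.
exact: degX_leXn.
Qed.

(** When each variable is replaced by a multiple of a monomial, a coefficient of
    the result is a sum over the exponents [h] with [\sum_j M j *+ h j = e]; the
    maps [s] and [r] let the caller parametrize this set of exponents. *)
Lemma fcoef_subst_mono (c : 'I_n -> R) (M : 'I_n -> 'X_{1..m})
    (e : 'X_{1..m}) (I : finType) (s : I -> 'X_{1..n}) (r : 'X_{1..n} -> I) (f : fps R n) :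
    (forall j, 0 < mdeg (M j))%N ->
    (forall x, (\sum_j M j *+ s x j)%MM = e) -> cancel s r ->
    (forall h : 'X_{1..n}, (\sum_j M j *+ h j)%MM = e -> s (r h) = h) ->
  fcoef (fps_subst (fun j => c j *: fmon R (M j)) f) e
    = \sum_x fcoef f (s x) * \prod_j c j ^+ s x j.
Proof.
move=> M_gt0 sM sK rK.
have prodE (h : 'X_{1..n}) : \prod_j (c j *: fmon R (M j)) ^+ h j
    = (\prod_j c j ^+ h j) *: fmon R (\sum_j M j *+ h j)%MM.
  by rewrite -fmon_prod; apply: eq_bigr => j _; rewrite exprZn fmonX.
have le_mdeg (h : 'X_{1..n}) : (\sum_j M j *+ h j)%MM = e -> (mdeg h < (mdeg e).+1)%N.
  move=> <-; rewrite ltnS mdeg_sum mdegE; apply: leq_sum => j _.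
  by rewrite mdegMn leq_pmull.
rewrite /= fcoef_sum.
rewrite (bigID (fun h : 'X_{1..n < (mdeg e).+1} => (\sum_j M j *+ h j)%MM == e)) /=.
rewrite [X in _ + X]big1 ?addr0; last first.
  by move=> h he; rewrite prodE fcoefZ /= eq_sym (negPf he) !mulr0.
pose s' x := BMultinom (le_mdeg _ (sM x)).
rewrite (reindex_onto s' (fun h => r h)); last first.
  by move=> h /eqP he; apply/val_inj; rewrite /= rK.
apply: eq_big => [x|x _]; first by rewrite /= sM sK !eqxx.
by rewrite prodE fcoefZ /= sM eqxx mulr1.
Qed.

End Substitution.

Definition mnm_of n (s : seq nat) : 'X_{1..n} := [multinom nth 0%N s l | l < n].

Lemma fcoef0_mono (R : comNzRingType) m (a : R) (M : 'X_{1..m}) :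
  (0 < mdeg M)%N -> fcoef (a *: fmon R M) 0%MM = 0.
Proof.
by rewrite fcoefZ /= eq_sym -mdeg_eq0 => /lt0n_neq0/negPf ->; rewrite mulr0.
Qed.

Local Notation iu := (@Ordinal 4 0 isT).
Local Notation iw := (@Ordinal 4 1 isT).
Local Notation iu' := (@Ordinal 4 2 isT).
Local Notation iw' := (@Ordinal 4 3 isT).
Local Notation ia := (@Ordinal 3 0 isT).
Local Notation ib := (@Ordinal 3 1 isT).
Local Notation ic := (@Ordinal 3 2 isT).
Local Notation iW := (@Ordinal 2 0 isT).
Local Notation iW' := (@Ordinal 2 1 isT).

Lemma mnm2E (h : 'X_{1..2}) : h = mnm_of 2 [:: h iW; h iW'].
Proof.
by apply/mnmP => -[[|[|//]] lt]; rewrite mnmE; congr (h _); apply/val_inj.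
Qed.

Lemma mnm3E (h : 'X_{1..3}) : h = mnm_of 3 [:: h ia; h ib; h ic].
Proof.
by apply/mnmP => -[[|[|[|//]]] lt]; rewrite mnmE; congr (h _); apply/val_inj.
Qed.

Lemma mnm4E (h : 'X_{1..4}) : h = mnm_of 4 [:: h iu; h iw; h iu'; h iw'].
Proof.
by apply/mnmP => -[[|[|[|[|//]]]] lt]; rewrite mnmE; congr (h _); apply/val_inj.
Qed.

Section Dehomogenization.
Variable k : fieldType.
Implicit Types (f : fps k 4) (r : fps k 3) (c z l : k).

(** [theta c z] is the substitution u := c W, w := W, u' := z W', w' := W'. It
    dehomogenizes each component that is homogeneous in (u, w) and in (u', w'):
    the coefficient of W^a W'^b is the component of bidegree (a, b) evaluated at
    u / w = c and u' / w' = z. *)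
Definition theta_coef c z (j : 'I_4) : k := [:: c; 1; z; 1]`_j.
Definition theta_exp (j : 'I_4) : 'X_{1..2} :=
  if (j < 2)%N then U_(iW)%MM else U_(iW')%MM.
Definition theta_vars c z (j : 'I_4) : fps k 2 :=
  theta_coef c z j *: fmon k (theta_exp j).

Lemma theta_exp_gt0 j : (0 < mdeg (theta_exp j))%N.
Proof. by rewrite /theta_exp; case: ifP; rewrite mdeg1. Qed.

Lemma theta_vars0 c z j : fcoef (theta_vars c z j) 0%MM = 0.
Proof. by apply: fcoef0_mono; apply: theta_exp_gt0. Qed.

Definition theta c z := fps_subst_morph (theta_vars0 c z).
HB.instance Definition _ c z := GRing.LRMorphism.on (theta c z).

Lemma theta_u c z : theta c z (ps_u k) = c *: fmon k U_(iW).
Proof. exact: fps_substX. Qed.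
Lemma theta_w c z : theta c z (ps_w k) = fmon k U_(iW).
Proof. by rewrite -[RHS]scale1r; exact: fps_substX. Qed.
Lemma theta_u' c z : theta c z (ps_u' k) = z *: fmon k U_(iW').
Proof. exact: fps_substX. Qed.
Lemma theta_w' c z : theta c z (ps_w' k) = fmon k U_(iW').
Proof. by rewrite -[RHS]scale1r; exact: fps_substX. Qed.

(** In the coordinates u / w and u' / w' the action is the diagonal translation. *)
Lemma theta_act c z l f : theta c z (ps_act l f) = theta (c + l) (z + l) f.
Proof.
rewrite /theta /ps_act fps_subst_comp; congr fps_subst; apply/funext => j.
rewrite -/(theta c z).
case: j => [[|[|[|[|//]]]] ?]; rewrite /act_vars /= /theta_vars /theta_coef /theta_exp /=.
- by rewrite linearD linearZ /= theta_u theta_w scalerDl.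
- by rewrite theta_w scale1r.
- by rewrite linearD linearZ /= theta_u' theta_w' scalerDl.
- by rewrite theta_w' scale1r.
Qed.

(** The substitution a := W, b := W', c := z W W'. It is the composite of [theta]
    with the map of the theorem, because w u' - w' u is w w' times the difference
    of u' / w' and u / w. *)
Definition eta_coef z (j : 'I_3) : k := [:: 1; 1; z]`_j.
Definition eta_exp (j : 'I_3) : 'X_{1..2} :=
  nth 0%MM [:: U_(iW); U_(iW'); U_(iW) + U_(iW')]%MM j.
Definition eta_vars z (j : 'I_3) : fps k 2 := eta_coef z j *: fmon k (eta_exp j).

Lemma theta_hom c z r : theta c z (ps_hom r) = fps_subst (eta_vars (z - c)) r.
Proof.
rewrite /theta /ps_hom fps_subst_comp; congr fps_subst; apply/funext => j.
rewrite -/(theta c z).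
case: j => [[|[|[|//]]] ?]; rewrite /hom_vars /= /eta_vars /eta_coef /eta_exp /=.
- by rewrite theta_w scale1r.
- by rewrite theta_w' scale1r.
- rewrite rmorphB !rmorphM /= theta_u theta_w theta_u' theta_w'.
  by rewrite -!scalerAr !fmonM [(U_(iW') + U_(iW))%MM]addmC scalerBl.
Qed.

Lemma fcoef_theta c z f a b :
  fcoef (theta c z f) (mnm_of 2 [:: a; b])
    = \sum_(i < a.+1) \sum_(j < b.+1)
        fcoef f (mnm_of 4 [:: i : nat; a - i; j : nat; b - j]%N) * (c ^+ i * z ^+ j).
Proof.
rewrite pair_big /=.
pose s (x : 'I_a.+1 * 'I_b.+1) :=
  mnm_of 4 [:: x.1 : nat; a - x.1; x.2 : nat; b - x.2]%N.
have sumE (h : 'X_{1..4}) : (\sum_j theta_exp j *+ h j)%MM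
    = mnm_of 2 [:: h iu + h iw; h iu' + h iw']%N.
  rewrite !big_ord_recl big_ord0; apply/mnmP => l.
  rewrite !mnmDE !mulmnE mnm0E /theta_exp /= !mnm1E mnmE.
  by case: l => [[|[|//]] ?] /=; rewrite ?mul0n ?mul1n ?addn0 ?add0n;
    congr addn; congr (h _); apply/val_inj.
rewrite [LHS](@fcoef_subst_mono _ _ _ (theta_coef c z) theta_exp _ _ s
  (fun h => (inord (h iu), inord (h iu')))).
- apply: eq_bigr => x _; congr (_ * _).
  rewrite !big_ord_recl big_ord0 /theta_coef /= !expr1n !mul1r !mulr1.
  by rewrite !mnmE.
- exact: theta_exp_gt0.
- move=> x; rewrite sumE !mnmE /= !subnKC ?leq_ord //.
- by move=> [x y]; rewrite /s !mnmE /= !inord_val.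
- move=> h; rewrite sumE => /mnmP hE.
  have := hE iW; have := hE iW'; rewrite !mnmE /= => hb ha.
  by rewrite [RHS]mnm4E /s /= !inordK ?ltnS -?ha -?hb ?leq_addr // !addKn.
Qed.

Lemma fcoef_eta z r a b :
  fcoef (fps_subst (eta_vars z) r) (mnm_of 2 [:: a; b])
    = \sum_(m < (minn a b).+1)
        fcoef r (mnm_of 3 [:: a - m; b - m; m : nat]%N) * z ^+ m.
Proof.
pose s (m : 'I_(minn a b).+1) := mnm_of 3 [:: a - m; b - m; m : nat]%N.
have sumE (h : 'X_{1..3}) : (\sum_j eta_exp j *+ h j)%MM
    = mnm_of 2 [:: h ia + h ic; h ib + h ic]%N.
  rewrite !big_ord_recl big_ord0; apply/mnmP => l.
  rewrite !mnmDE !mulmnE mnm0E /eta_exp /= ?mnmDE !mnm1E mnmE.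
  by case: l => [[|[|//]] ?] /=; rewrite ?mul0n ?mul1n ?addn0 ?add0n;
    congr addn; congr (h _); apply/val_inj.
rewrite [LHS](@fcoef_subst_mono _ _ _ (eta_coef z) eta_exp _ _ s
  (fun h => inord (h ic))).
- apply: eq_bigr => x _; congr (_ * _).
  rewrite !big_ord_recl big_ord0 /eta_coef /= !expr1n !mul1r !mulr1.
  by rewrite !mnmE.
- by case=> [[|[|[|//]]] ?]; rewrite /eta_exp /= ?mdegD !mdeg1.
- by move=> x; rewrite sumE !mnmE /= !subnK //; have := leq_ord x; lia.
- by move=> x; rewrite /s !mnmE /= !inord_val.
- move=> h; rewrite sumE => /mnmP hE.
  have := hE iW; have := hE iW'; rewrite !mnmE /= => hb ha.
  have h2 : (h ic <= minn a b)%N by rewrite leq_min -ha -hb !leq_addl.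
  by rewrite [RHS]mnm3E /s inordK ?ltnS // -ha -hb !addnK.
Qed.

End Dehomogenization.

(** * Counting roots in the field with q elements *)

Section RootCounting.
Variables (k : closedFieldType) (p s : nat).
Hypotheses (chp : p \in [pchar k]) (s_gt0 : (0 < s)%N).
Local Notation q := (p ^ s)%N.

Lemma q_gt1 : (1 < q)%N.
Proof.
have p1 := prime_gt1 (pcharf_prime chp).
by rewrite -(exp1n s) ltn_exp2r.
Qed.

Lemma natr_q : q%:R = 0 :> k.
Proof. by rewrite natrX (pcharf0 chp) expr0n -[s == 0%N]negbK -lt0n s_gt0. Qed.

(** The derivative of [X ^+ q - X] is -1, so its roots are simple. *)
Lemma Fq_enum :
  exists rs : seq k, [/\ uniq rs, size rs = q & {in rs, forall l, l ^+ q = l}].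
Proof.
have q1 := q_gt1.
have szX : (size (- 'X : {poly k}) < size ('X^q : {poly k}))%N.
  by rewrite size_polyN size_polyX size_polyXn ltnS.
have szF : size ('X^q - 'X : {poly k}) = q.+1.
  by rewrite size_polyDl // size_polyXn.
have [rs] := closed_field_poly_normal ('X^q - 'X : {poly k}).
rewrite lead_coefDl // lead_coefXn scale1r => FE.
exists rs; split=> [||l lrs].
- rewrite -separable_prod_XsubC -FE unlock derivB derivX derivXn.
  rewrite -scaler_nat natr_q scale0r sub0r.
  by rewrite -[X in coprimep _ X]scaleN1r coprimepZr ?coprimep1 ?oppr_eq0 ?oner_eq0.
- by apply: succn_inj; rewrite -szF FE size_prod_XsubC.
- have : root ('X^q - 'X) l by rewrite FE root_prod_XsubC.
  by rewrite rootE !hornerE subr_eq0 => /eqP.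
Qed.

(** A polynomial with more roots than its degree is zero. The bound [N] is
    independent of q so that the lemma applies to bihomogeneous components of
    any degree, whose coefficients vanish from q on. *)
Lemma Fq_vanish (a : nat -> k) N :
    (forall m, (q <= m)%N -> a m = 0) ->
    (forall l, l ^+ q = l -> \sum_(m < N) a m * l ^+ m = 0) ->
  forall m, (m < N)%N -> a m = 0.
Proof.
move=> aq a_sum m mN; have [rs [rs_uniq rs_size rsq]] := Fq_enum.
pose F : {poly k} := \poly_(i < N) a i.
have F0 : F = 0.
  apply: contraTeq (leqnn q) => F0; rewrite -ltnNge.
  have rsF : all (root F) rs.
    by apply/allP => l /rsq lq; rewrite rootE horner_poly a_sum.
  rewrite -{1}rs_size; apply: leq_trans (max_poly_roots F0 rsF rs_uniq) _.
  apply/leq_sizeP => j qj; rewrite coef_poly; case: ifP => // _.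
  exact: aq.
by have := coef_poly N a m; rewrite mN -/F F0 coef0.
Qed.

End RootCounting.

(** * The map and the action on normal forms *)

Section NormalForms.
Variables (k : fieldType) (d : nat).
Implicit Types (f : fps k 4) (r : fps k 3).

Definition bounded f := degX_le iu d f /\ degX_le iu' d f.

Lemma bounded_hom r : degX_le ic d r -> bounded (ps_hom r).
Proof.
move=> rd; split.
- apply: (@degX_le_subst _ _ _ _ _ (fun j => nth 0%N [:: 0; 0; 1] j)%N).
    case=> [[|[|[|//]]] ?]; rewrite /hom_vars /=;
      try exact: (@degX_leX _ _ iu).
    apply: degX_leB; last first.
      exact: (@degX_leM _ _ _ 0 1 _ _ (@degX_leX _ _ iu iw') (@degX_leX _ _ iu iu)).
    apply: (@degX_leW _ _ _ 0 1) => //.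
    exact: (@degX_leM _ _ _ 0 0 _ _ (@degX_leX _ _ iu iw) (@degX_leX _ _ iu iu')).
  move=> h /rd; rewrite !big_ord_recl big_ord0 /= !mul0n mul1n addn0 !add0n.
  by congr (_ <= _)%N; congr (h _); apply/val_inj.
- apply: (@degX_le_subst _ _ _ _ _ (fun j => nth 0%N [:: 0; 0; 1] j)%N).
    case=> [[|[|[|//]]] ?]; rewrite /hom_vars /=;
      try exact: (@degX_leX _ _ iu').
    apply: degX_leB; first
      exact: (@degX_leM _ _ _ 0 1 _ _ (@degX_leX _ _ iu' iw) (@degX_leX _ _ iu' iu')).
    apply: (@degX_leW _ _ _ 0 1) => //.
    exact: (@degX_leM _ _ _ 0 0 _ _ (@degX_leX _ _ iu' iw') (@degX_leX _ _ iu' iu)).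
  move=> h /rd; rewrite !big_ord_recl big_ord0 /= !mul0n mul1n addn0 !add0n.
  by congr (_ <= _)%N; congr (h _); apply/val_inj.
Qed.

Lemma bounded_act (l : k) f : bounded f -> bounded (ps_act l f).
Proof.
case=> f0 f2; split.
- apply: (@degX_le_subst _ _ _ _ _ (fun j => nth 0%N [:: 1; 0; 0; 0] j)%N).
    case=> [[|[|[|[|//]]]] ?]; rewrite /act_vars /=;
      try exact: (@degX_leX _ _ iu).
      apply: degX_leD (@degX_leX _ _ iu iu) _; apply: degX_leZ.
      exact: (@degX_leW _ _ _ 0 1 _ _ (@degX_leX _ _ iu iw)).
    apply: degX_leD (@degX_leX _ _ iu iu') _; apply: degX_leZ.
    exact: (@degX_leX _ _ iu iw').
  move=> h /f0; rewrite !big_ord_recl big_ord0 /= !mul0n mul1n !addn0.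
  by congr (_ <= _)%N; congr (h _); apply/val_inj.
- apply: (@degX_le_subst _ _ _ _ _ (fun j => nth 0%N [:: 0; 0; 1; 0] j)%N).
    case=> [[|[|[|[|//]]]] ?]; rewrite /act_vars /=;
      try exact: (@degX_leX _ _ iu').
      apply: degX_leD (@degX_leX _ _ iu' iu) _; apply: degX_leZ.
      exact: (@degX_leX _ _ iu' iw).
    apply: degX_leD (@degX_leX _ _ iu' iu') _; apply: degX_leZ.
    exact: (@degX_leW _ _ _ 0 1 _ _ (@degX_leX _ _ iu' iw')).
  move=> h /f2; rewrite !big_ord_recl big_ord0 /= !mul0n mul1n !addn0 !add0n.
  by congr (_ <= _)%N; congr (h _); apply/val_inj.
Qed.

Lemma boundedB f g : bounded f -> bounded g -> bounded (f - g).
Proof. by case=> f0 f2 [g0 g2]; split; apply: degX_leB. Qed.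

End NormalForms.

(** * Invariant normal forms *)

Section InvariantNormalForms.
Variables (k : closedFieldType) (p s : nat).
Hypotheses (chp : p \in [pchar k]) (s_gt0 : (0 < s)%N).
Local Notation q := (p ^ s)%N.

Lemma bounded_coef0 (f : fps k 4) i x j y : bounded q.-1 f ->
  (q <= i)%N || (q <= j)%N -> fcoef f (mnm_of 4 [:: i; x; j; y]) = 0.
Proof.
move=> [/(_ (mnm_of 4 [:: i; x; j; y])) f0 /(_ (mnm_of 4 [:: i; x; j; y])) f2].
rewrite !mnmE /= in f0 f2; have := q_gt0 s chp.
by case: eqP f0 f2 => // _ /(_ isT) + /(_ isT); lia.
Qed.

(** Each bihomogeneous component of [g] dehomogenizes to a polynomial of degree
    less than q in both variables; it is zero once it vanishes on all pairs of
    elements of the field of order q. *)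
Lemma theta_eq0 (g : fps k 4) : bounded q.-1 g ->
  (forall l z, l ^+ q = l -> theta l z g = 0) -> g = 0.
Proof.
move=> gq g0; apply/fpsP => e; rewrite [e]mnm4E.
move: (e iu) (e iw) (e iu') (e iw') => i x j y.
set a := (i + x)%N; set b := (j + y)%N.
pose c i j := fcoef g (mnm_of 4 [:: i; a - i; j; b - j]%N).
suff : c i j = 0 by rewrite /c /a /b !addKn.
apply: (@Fq_vanish _ _ _ chp s_gt0 (c i) b.+1); last by rewrite ltnS leq_addr.
  by move=> m qm; apply: bounded_coef0; rewrite // qm orbT.
move=> z _.
apply: (@Fq_vanish _ _ _ chp s_gt0 (fun i => \sum_(j < b.+1) c i j * z ^+ j) a.+1).
- move=> m qm; rewrite big1 // => l _.
  by rewrite /c bounded_coef0 ?mul0r // qm.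
- move=> l lq; transitivity (fcoef (theta l z g) (mnm_of 2 [:: a; b])).
    rewrite fcoef_theta; apply: eq_bigr => i' _; rewrite mulr_suml; apply: eq_bigr => j' _.
    by rewrite -mulrA [z ^+ _ * _]mulrC.
  by rewrite g0.
- by rewrite ltnS leq_addr.
Qed.

(** Setting u = 0 sends c to w u', and monomials in a, b, c to distinct
    monomials. *)
Lemma hom_inj (r : fps k 3) : degX_le ic q.-1 r -> ps_hom r = 0 -> r = 0.
Proof.
move=> rq r0; apply/fpsP => e; rewrite [e]mnm3E.
move: (e ia) (e ib) (e ic) => x y m.
set a := (x + m)%N; set b := (y + m)%N.
pose c m := fcoef r (mnm_of 3 [:: a - m; b - m; m]%N).
suff : c m = 0 by rewrite /c /a /b !addnK.
apply: (@Fq_vanish _ _ _ chp s_gt0 c (minn a b).+1); last first.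
  by rewrite ltnS leq_min !leq_addl.
- move=> z _; rewrite -fcoef_eta -[z]subr0 -theta_hom r0.
  by rewrite raddf0.
- move=> l ql; apply/eqP; apply: contraLR ql => /rq.
  by rewrite mnmE /=; have := q_gt0 s chp; lia.
Qed.

(** Write F(t, t') for the dehomogenized component of bidegree (a, b) of [f].
    Invariance gives F(l, y) = F(0, y - l) for the q values of l in the field of
    order q. Setting y = 0 and comparing coefficients in l shows that the degree
    of F(0, y) is at most a, as F has degree at most a in t; this makes it
    possible to lift F(0, y) to a series [r] in a, b, c. Then [f - ps_hom r] is
    invariant and vanishes at u = 0, so it vanishes at u = l w for all those l,
    hence is zero. *)
Lemma invariant_hom (f : fps k 4) : bounded q.-1 f ->
    (forall l, l ^+ q = l -> ps_act l f = f) ->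
  exists2 r, degX_le ic q.-1 r & ps_hom r = f.
Proof.
move=> fq f_inv.
(* the series with theta 0 z (ps_hom r) = theta 0 z f: at u = 0 the monomial
   a^x b^y c^m becomes w^(x + m) w'^y u'^m *)
pose r : fps k 3 := FPS (fun e => fcoef f (mnm_of 4 [:: 0; e ia + e ic; e ic; e ib]%N)).
have rq : degX_le ic q.-1 r.
  move=> e; apply: contraNT; rewrite -ltnNge => qe; apply/eqP.
  by apply: bounded_coef0 => //; have := q_gt0 s chp; lia.
have theta0E z a b : fcoef (theta 0 z f) (mnm_of 2 [:: a; b]) =
    \sum_(j < b.+1) fcoef f (mnm_of 4 [:: 0; a; j : nat; b - j]%N) * z ^+ j.
  rewrite fcoef_theta big_ord_recl [X in _ + X]big1 ?addr0 => [|i _].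
    by apply: eq_bigr => j _; rewrite subn0 expr0 mul1r.
  by rewrite big1 // => j _; rewrite exprS mul0r mul0r mulr0.
(* the coefficient of u'^m in f at u = 0 is divisible by w^m *)
have low_order a m b : (a < m)%N -> (m <= b)%N ->
    fcoef f (mnm_of 4 [:: 0; a; m; b - m]%N) = 0.
  move=> am mb.
  (* m-th coefficient in l of F(0, - l) - F(l, 0) *)
  pose c m := (if (m <= b)%N then (-1) ^+ m * fcoef f (mnm_of 4 [:: 0; a; m; b - m]%N) else 0)
     - (if (m <= a)%N then fcoef f (mnm_of 4 [:: m; a - m; 0; b]%N) else 0).
  suff : c m = 0.
    rewrite /c mb leqNgt am subr0 => /eqP.
    by rewrite mulf_eq0 signr_eq0 => /eqP.
  have ab : (a <= b)%N by apply: leq_trans (ltnW am) mb.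
  apply: (@Fq_vanish _ _ _ chp s_gt0 c b.+1) => //.
    move=> l ql; rewrite /c !bounded_coef0 ?ql ?orbT // mulr0.
    by rewrite !if_same subrr.
  move=> l lq; have := theta_act 0 (- l) l f; rewrite add0r addNr f_inv // => E.
  have := theta0E (- l) a b; rewrite E fcoef_theta => E2.
  rewrite (eq_bigr (fun m : 'I_b.+1 => fcoef f (mnm_of 4 [:: 0; a; m : nat; b - m]%N) * (- l) ^+ m -
    (if (m < a.+1)%N then fcoef f (mnm_of 4 [:: m : nat; a - m; 0; b]%N) * l ^+ m else 0))).
    rewrite sumrB -E2 -big_mkcond.
    rewrite -(big_ord_widen b.+1 (fun m => fcoef f (mnm_of 4 [:: m; a - m; 0; b]%N) * l ^+ m)) //.
    apply/eqP; rewrite subr_eq0; apply/eqP.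
    apply: eq_bigr => i _; rewrite big_ord_recl [X in _ + X]big1 ?addr0 => [|j _].
      by rewrite expr0 mulr1 subn0.
    by rewrite exprS mul0r !mulr0.
  move=> i _; rewrite /c leq_ord mulrBl ltnS.
  by case: ifP => _; rewrite -[- l]mulN1r exprMn ?mul0r; ring.
exists r => //; apply/esym/eqP; rewrite -subr_eq0; apply/eqP.
apply: theta_eq0 => [|l z lq].
  exact/boundedB/bounded_hom.
have -> : theta l z (f - ps_hom r) = theta 0 (z - l) (f - ps_hom r).
  rewrite !raddfB /= !theta_hom subr0; congr (_ - _).
  by have := theta_act 0 (z - l) l f; rewrite add0r subrK f_inv.
apply/fpsP => e; rewrite [e]mnm2E; move: (e iW) (e iW') => a b.
have -> : theta 0 (z - l) (f - ps_hom r)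
    = theta 0 (z - l) f - theta 0 (z - l) (ps_hom r) by exact: raddfB.
rewrite fcoefB theta0E theta_hom subr0 fcoef_eta.
rewrite (big_ord_widen b.+1 (fun m => fcoef r (mnm_of 3 [:: a - m; b - m; m]%N) * (z - l) ^+ m)).
  rewrite [X in _ - X]big_mkcond -sumrB big1 // => m _ /=.
  rewrite !mnmE /= ltnS leq_min leq_ord andbT; case: leqP => am.
    by rewrite subnK // subrr.
  by rewrite low_order ?leq_ord // mul0r subrr.
by rewrite ltnS geq_minr.
Qed.

End InvariantNormalForms.

(** * Normal forms modulo the relations *)

Section Reduction.
Variables (k : closedFieldType) (p s : nat).
Hypotheses (chp : p \in [pchar k]) (s_gt0 : (0 < s)%N).
Variables mu mu' : nat -> k.
Local Notation q := (p ^ s)%N.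
Local Notation P := (unit_slope_poly q mu).
Local Notation Q := (unit_slope_poly q mu').

Lemma degX_le_horner n (i : 'I_n) (x : fps k n) nu :
  degX_le i 0 x -> degX_le i 0 (horner_alg x (unit_slope_poly q nu)).
Proof.
move=> x0; rewrite horner_alg_unit_slope; apply: degX_leD => //.
by apply: degX_le_sum => j _; apply: degX_leZ; exact: (degX_leXn x0).
Qed.

Lemma ord_off_horner n (i : 'I_n) (x : fps k n) nu :
  ord_off i 1 x -> ord_off i 1 (horner_alg x (unit_slope_poly q nu)).
Proof.
move=> x1; rewrite horner_alg_unit_slope; apply: ord_offD => //.
rewrite big_nat_cond; apply: ord_off_sum => j /andP[/andP[j2 _] _] e.
rewrite fcoefZ => nz; apply: (ord_offXn x1 (ltnW j2)).
by apply: contraNneq nz => ->; rewrite mulr0.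
Qed.

Let q1 : (0 < q.-1)%N.
Proof. by have := q_gt1 chp s_gt0; lia. Qed.
Let q0 : (0 < q)%N := q_gt0 s chp.

Let hu : fps k 4 := ps_u k * ps_w k ^+ q.-1 + horner_alg (ps_w k) P.
Let hu' : fps k 4 := ps_u' k * ps_w' k ^+ q.-1 + horner_alg (ps_w' k) Q.
Let hc : fps k 3 := (ps_a k * ps_b k) ^+ q.-1 * ps_c k
  + ps_a k ^+ q * horner_alg (ps_b k) Q - ps_b k ^+ q * horner_alg (ps_a k) P.

Let relsAE : relsA p s mu mu' = [:: ps_u k ^+ q - hu; ps_u' k ^+ q - hu'].
Proof. by rewrite /relsA /hu /hu' !opprD !addrA. Qed.

Let relsBE : relsB p s mu mu' = [:: ps_c k ^+ q - hc].
Proof. by rewrite /relsB /hc !opprD opprK !addrA. Qed.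

Let hu_ord : ord_off iu 1 hu.
Proof.
apply: ord_offD; last by apply/ord_off_horner/ord_offX.
by apply: (@ord_offM _ _ _ 0 1) => //; apply: ord_offXn => //; apply: ord_offX.
Qed.

Let hu'_ord : ord_off iu' 1 hu'.
Proof.
apply: ord_offD; last by apply/ord_off_horner/ord_offX.
by apply: (@ord_offM _ _ _ 0 1) => //; apply: ord_offXn => //; apply: ord_offX.
Qed.

Let hc_ord : ord_off ic 1 hc.
Proof.
have a1 : ord_off ic 1 (ps_a k) by apply: ord_offX.
have b1 : ord_off ic 1 (ps_b k) by apply: ord_offX.
have X1 (x y : fps k 3) : ord_off ic 1 x -> ord_off ic 1 (x * y).
  by move=> x1; apply: (@ord_offM _ _ _ 1 0).
apply: ord_offD; [apply: ord_offD | apply: ord_offN]; apply: (X1); apply: ord_offXn => //.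
exact: X1.
Qed.

(** The relation between u' and w' does not involve u, so multiplication by it
    preserves the degree in u. *)
Let rel2_deg : degX_le iu 0 (ps_u' k ^+ q - hu').
Proof.
apply: degX_leB; first exact: (degX_leXn (@degX_leX _ _ iu iu')).
apply: degX_leD; last exact/degX_le_horner/(@degX_leX _ _ iu iw').
apply: (@degX_leM _ _ _ 0 0); first exact: (@degX_leX _ _ iu iu').
exact: (degX_leXn (@degX_leX _ _ iu iw')).
Qed.

Lemma mem_idealA f : f \in idealA s mu mu' chp <->
  exists Q1 Q2, f = (ps_u k ^+ q - hu) * Q1 + (ps_u' k ^+ q - hu') * Q2.
Proof.
split=> [/ideal_genP[c]|[Q1 [Q2 fE]]].
  rewrite relsAE !big_ord_recl big_ord0 /= addr0 => ->.
  by exists (c 0%N), (c 1%N); rewrite ![c _ * _]mulrC.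
rewrite -[_ \in _]/(f \in ideal_gen (relsA p s mu mu')) relsAE.
apply/ideal_genP; exists (fun i => if i == 0%N then Q1 else Q2).
by rewrite !big_ord_recl big_ord0 /= addr0 fE; congr (_ + _); apply: mulrC.
Qed.

(** Division by the relation in u, then by the relation in u'. The second
    quotient is truncated in u: this keeps the remainder of degree less than q in
    u, since the second relation does not involve u. *)
Lemma idealA_reduce f : exists2 r, bounded q.-1 r & f - r \in idealA s mu mu' chp.
Proof.
have [Q1 r1] := weierstrass_div q0 hu_ord f.
have [Q2 r2] := weierstrass_div q0 hu'_ord (f - (ps_u k ^+ q - hu) * Q1).
exists (f - (ps_u k ^+ q - hu) * Q1 - (ps_u' k ^+ q - hu') * truncX iu q.-1 Q2).
  rewrite -(truncXM _ _ rel2_deg) -{1}(truncX_id r1) -truncXB.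
  by split; [apply: truncX_deg | apply: degX_le_trunc].
apply/mem_idealA; exists Q1, (truncX iu q.-1 Q2).
by rewrite -addrA -opprD subKr.
Qed.

(** In [F1 * Q1 + F2 * Q2], where F1 and F2 are the relations in u and u', one may
    change [Q2] modulo F1 and assume that it has degree less than q in u. So has
    then [F1 * Q1], and uniqueness of division kills [Q1], then [Q2]. *)
Lemma idealA_bounded r : bounded q.-1 r -> r \in idealA s mu mu' chp -> r = 0.
Proof.
move=> [r0 r2] /mem_idealA[Q1 [Q2 rE]].
have [Q' Sd] := weierstrass_div q0 hu_ord Q2; set S := Q2 - _ in Sd.
have {}rE : r = (ps_u k ^+ q - hu) * (Q1 + (ps_u' k ^+ q - hu') * Q')
    + (ps_u' k ^+ q - hu') * S.
  by rewrite rE /S; ring.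
have Q0 : Q1 + (ps_u' k ^+ q - hu') * Q' = 0.
  apply: (weierstrass_uniq q0 hu_ord).
  by have := degX_leB r0 (degX_leM rel2_deg Sd); rewrite {1}rE addrK.
rewrite Q0 mulr0 add0r in rE.
by rewrite rE (weierstrass_uniq q0 hu'_ord (Q := S)) ?mulr0 // -rE.
Qed.

Lemma idealB_reduce f :
  exists2 r, degX_le ic q.-1 r & f - r \in idealB s mu mu' chp.
Proof.
have [Q1 r1] := weierstrass_div q0 hc_ord f.
exists (f - (ps_c k ^+ q - hc) * Q1) => //.
apply/ideal_genP; exists (fun=> Q1).
by rewrite relsBE big_ord_recl big_ord0 /= addr0 opprB addrC subrK mulrC.
Qed.

End Reduction.

Theorem proposition2p2 (k : closedFieldType) (p s : nat)
    (chp : p \in [pchar k]) (s_gt0 : (0 < s)%N) (mu mu' : nat -> k) :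
  let phi : {lrmorphism ringB s chp mu mu' -> invRing s chp mu mu'} :=
    quot_hom s chp mu mu' in
  let u := projA s chp mu mu' (ps_u k) in
  let w := projA s chp mu mu' (ps_w k) in
  let u' := projA s chp mu mu' (ps_u' k) in
  let w' := projA s chp mu mu' (ps_w' k) in
  [/\ invRing_val (phi (projB s chp mu mu' (ps_a k))) = w,
      invRing_val (phi (projB s chp mu mu' (ps_b k))) = w',
      invRing_val (phi (projB s chp mu mu' (ps_c k))) = w * u' - w' * u
    & bijective phi].
Proof.
move=> phi u w u' w'.
have projA0 f : (projA s chp mu mu' f == 0) = (f \in idealA s mu mu' chp).
  exact: quot_proj_eq0.
have projB0 f : (projB s chp mu mu' f == 0) = (f \in idealB s mu mu' chp).
  exact: quot_proj_eq0.
have reduceB x : exists2 r, degX_le ic (p ^ s).-1 r & x = projB s chp mu mu' r.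
  have [f ->] := quot_projP x.
  have [r rq fr] := idealB_reduce chp s_gt0 mu mu' f; exists r => //.
  by apply/eqP; rewrite -subr_eq0 -[quot_proj _ _]/(projB s chp mu mu' f) -rmorphB projB0.
have reduceA x : exists2 f, bounded (p ^ s).-1 f & x = projA s chp mu mu' f.
  have [f ->] := quot_projP x.
  have [r rq fr] := idealA_reduce chp s_gt0 mu mu' f; exists r => //.
  by apply/eqP; rewrite -subr_eq0 -[quot_proj _ _]/(projA s chp mu mu' f) -rmorphB projA0.
have phi_inj : injective phi.
  apply: raddf_inj => x; have [r rq ->] := reduceB x.
  move=> /(congr1 (@invRing_val _ _ _ _ _ _)); rewrite quot_homE => /eqP.
  rewrite projA0 => /(idealA_bounded s_gt0 (bounded_hom rq))/hom_inj.
  by move=> /(_ _ _ chp s_gt0 rq) ->; rewrite rmorph0.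
have phi_surj (y : invRing s chp mu mu') : exists x, phi x = y.
  case: y => y y_inv; have [f fq yE] := reduceA y.
  have [|r rq rf] := invariant_hom chp s_gt0 fq.
    move=> l lq; have := invariantP _ y_inv (exist _ l (introT eqP lq)).
    rewrite yE act_proj => /eqP; rewrite -subr_eq0 -rmorphB projA0.
    (* the action preserves normal forms, so invariance modulo the relations is
       an equality of series *)
    move/(idealA_bounded s_gt0 (boundedB (bounded_act l fq) fq))/eqP.
    by rewrite subr_eq0 => /eqP.
  exists (projB s chp mu mu' r); apply/val_inj.
  by apply: etrans (quot_homE _ _ _ _ _) _; rewrite rf -yE.
split; [by rewrite quot_homE ps_hom_a | by rewrite quot_homE ps_hom_b | |].
  by rewrite quot_homE ps_hom_c rmorphB !rmorphM.
have [psi psiK] := choice phi_surj.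
by exists psi => // x; apply: phi_inj; rewrite psiK.
Qed.
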